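(* Let $I$ be an unmixed proper monomial ideal in a polynomial ring $S=K[x_1,\ldots,x_n]$ over a field $K$ of any characteristic, and let $I^{\mathcal{P}}\subset S^{\mathcal{P}}$ be its polarization. Let $p$ be a prime number with $p>\dim S^{\mathcal{P}}$. Then $$\mathrm{v}(I)=\mathrm{v}(I^{\mathcal{P}})=\left\lceil \frac{\alpha_p(I^{\mathcal{P}})}{p}\right\rceil-\mathrm{ht}(I),$$ where $\alpha_p(I^{\mathcal{P}})$ is computed by regarding $I^{\mathcal{P}}$ as the monomial ideal with the same monomial generators in the polynomial ring with the same variables over a field of characteristic $p$.
   Context: For a monomial ideal $I$ with minimal monomial generators $u_1,\ldots,u_r$, let $a_i$ be the largest exponent of $x_i$ occurring in $u_1,\ldots,u_r$. Put $S^{\mathcal{P}}=K[x_{i,j}: 1\le i\le n,\ 1\le j\le a_i]$. The polarization of a monomial $u=x_1^{b_1}\cdots x_n^{b_n}$ is $u^{\mathcal{P}}=\prod_{i=1}^n\prod_{j=1}^{b_i}x_{i,j}$, and $I^{\mathcal{P}}=(u_1^{\mathcal{P}},\ldots,u_r^{\mathcal{P}})\subset S^{\mathcal{P}}$. All polynomial rings carry the standard grading. For a proper graded ideal $J$ of a polynomial ring $T$, the v-number is $\mathrm{v}(J)=\min\{d\ge 0\mid \exists f\in T_d \text{ and } \mathfrak{p}\in\mathrm{Ass}(J)\text{ with } J:f=\mathfrak{p}\}$, where $\mathrm{Ass}(J)$ is the set of associated primes of $T/J$ (for monomial ideals $\mathrm{v}(J)$ does not depend on the field). The height $\mathrm{ht}(J)$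 (respectively big height) is the minimum (respectively maximum) of the heights of the associated primes of $J$; $J$ is unmixed if these coincide. If $T$ is over a field of characteristic $p$, then $J^{[p]}=(a^p: a\in J)$ and $\alpha_p(J)=\min\left\{d \,\middle|\, \left[\frac{J^{[p]}:J}{J^{[p]}}\right]_d\ne 0\right\}$, the least degree of a homogeneous element of $(J^{[p]}:J)\setminus J^{[p]}$. $\lceil z\rceil$ denotes the least integer greater than or equal to $z$. *)

(* Defs.v *)
From HB Require Import structures.
From mathcomp Require Import all_boot all_order all_algebra.
From mathcomp Require Import mpoly.
From mathcomp Require Import boolp classical_sets.

Set Implicit Arguments.
Unset Strict Implicit.
Unset Printing Implicit Defensive.

Import GRing.Theory.

Local Open Scope classical_set_scope.
Local Open Scope ring_scope.

Definition is_min (A : set nat) (m : nat) : Prop :=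
  A m /\ forall k, A k -> (m <= k)%N.

Definition is_max (A : set nat) (m : nat) : Prop :=
  A m /\ forall k, A k -> (k <= m)%N.

Section Ideals.
Variable R : comNzRingType.

(* Ideals are arbitrary subsets of R: the closure predicates of the library
   (idealr_closed, prime_idealr_closed) only cover boolean predicates. *)
Definition is_ideal (J : set R) : Prop :=
  [/\ J 0, forall x y, J x -> J y -> J (x + y)
    & forall a x, J x -> J (a * x)].

Definition ideal_gen (G : set R) : set R := smallest is_ideal G.

Definition is_proper_ideal (J : set R) : Prop := is_ideal J /\ ~ J 1.

Definition is_prime_ideal (P : set R) : Prop :=
  is_proper_ideal P /\ forall x y, P (x * y) -> P x \/ P y.

Definition colon (J G : set R) : set R :=
  [set g | forall x, G x -> J (g * x)].

(* J : f is the annihilator of the class of f in R / J, so this is Ass(R / J). *)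
Definition Ass (J : set R) : set (set R) :=
  [set P | is_prime_ideal P /\ exists f, colon J [set f] = P].

(* c 0 < c 1 < ... < c k, a chain of length k; c is irrelevant beyond k *)
Definition prime_chain (k : nat) (c : nat -> set R) : Prop :=
  (forall i, (i <= k)%N -> is_prime_ideal (c i)) /\
  (forall i, (i < k)%N -> c i `<` c i.+1).

Definition is_krull_dim (d : nat) : Prop :=
  is_max [set k | exists c, prime_chain k c] d.

Definition prime_height (P : set R) (h : nat) : Prop :=
  is_max [set k | exists c, prime_chain k c /\ c k = P] h.

Definition ass_heights (J : set R) : set nat :=
  [set h | exists P, Ass J P /\ prime_height P h].

Definition is_height (J : set R) (h : nat) : Prop := is_min (ass_heights J) h.

Definition is_big_height (J : set R) (h : nat) : Prop :=
  is_max (ass_heights J) h.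

Definition unmixed (J : set R) : Prop :=
  exists h, is_height J h /\ is_big_height J h.

Definition frobenius_power (p : nat) (J : set R) : set R :=
  ideal_gen [set x | exists2 a, J a & x = a ^+ p].

End Ideals.

Section Graded.
Variables (n : nat) (K : fieldType).

Definition is_vnumber (J : set {mpoly K[n]}) (v : nat) : Prop :=
  is_min [set d | exists f : {mpoly K[n]},
            f \is d.-homog /\ exists P, Ass J P /\ colon J [set f] = P] v.

(* J^[p] is homogeneous when J is, so degree d of (J^[p] : J) / J^[p] is nonzero
   iff some form of degree d lies in J^[p] : J but not in J^[p]. *)
Definition is_alpha (p : nat) (J : set {mpoly K[n]}) (a : nat) : Prop :=
  is_min [set d | exists f : {mpoly K[n]},
            f \is d.-homog /\
            (colon (frobenius_power p J) J `\` frobenius_power p J) f] a.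

Definition monomial_ideal (u : seq 'X_{1..n}) : set {mpoly K[n]} :=
  ideal_gen [set f | exists2 m, m \in u & f = 'X_[m]].

(* No generator is redundant; in particular u has no repetition. *)
Definition minimal_monomial_generators
    (I : set {mpoly K[n]}) (u : seq 'X_{1..n}) : Prop :=
  I = monomial_ideal u /\
  forall m, m \in u -> I <> monomial_ideal (rem m u).

End Graded.

Section Polarization.
Variables (n : nat) (u : seq 'X_{1..n}).

Definition max_exp (i : 'I_n) : nat := \max_(m <- u) m i.

(* (i, j) indexes the variable x_{i,j+1} of the polarization ring. *)
Definition pol_index := {i : 'I_n & 'I_(max_exp i)}.

Definition pol_nvars : nat := #|{: pol_index}|.

Variable K : fieldType.

Definition pol_var (i : 'I_n) (j : 'I_(max_exp i)) : {mpoly K[pol_nvars]} :=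
  'X_(enum_rank (Tagged (fun i => 'I_(max_exp i)) j)).

(* Meant for m in u, where m i <= max_exp i. *)
Definition polarize (m : 'X_{1..n}) : {mpoly K[pol_nvars]} :=
  \prod_(i < n) \prod_(j < max_exp i | (j < m i)%N) pol_var j.

Definition polarization : set {mpoly K[pol_nvars]} :=
  ideal_gen [set f | exists2 m, m \in u & f = polarize m].

End Polarization.

Arguments pol_nvars {n} u.
Arguments polarization {n} u K.
Arguments is_krull_dim R d : clear implicits.

(* Main.v *)
Require Import Defs.
From mathcomp Require Import all_boot all_order all_algebra.
From mathcomp Require Import mpoly.
From mathcomp Require Import boolp.
From mathcomp Require Import zify.

(** Everything is read off exponent vectors. For a monomial ideal with generators
    [u], a prime of the form I : f is generated by a set A of variables, and some
    monomial x^w of f already satisfies I : x^w = (x_i : i in A)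
    ([colon_witness], [witness_colon]). So v(I) is the least degree of a [witness]
    and does not see the field ([is_vnumberE]). Likewise alpha_p of a monomial
    ideal in characteristic p is the least degree of an exponent e with x^e in
    I^[p] : I but not in I^[p] ([is_alphaE]), as I^[p] is generated by the p-th
    powers of the monomial generators.

    Unmixedness enters as: every witness has the same number h = ht(I) of
    variables ([unmixed_witness]). This uses that a prime generated by variables
    has height equal to their number, hence that a chain of primes in
    K[x_1, ..., x_n] has length at most n; the latter follows from the algebraic
    dependence of any n + 1 polynomials ([prime_chain_le]). Adding the
    variables of S^P one by one gives a chain of primes in S^P, so their number N is
    at most dim S^P ([krull_dim_ge]), and N < p.

    The minimal primes of I^P are its minimal vertex covers. Such a cover contains
    at most one x_{i,j} for each i, and raising its levels j as far as possible
    yields a witness of I; so all of them have size h ([card_min_cover]). A witness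
    of I polarizes to one of I^P ([witness_polarize]); conversely, a witness of I^P
    is turned into one of I of no larger degree by counting, for each i, the
    x_{i,j} dividing it, correcting the count on the cover, and invoking
    unmixedness ([witness_depolarize]). Hence v(I) = v(I^P) = v.

    Finally, for the squarefree ideal I^P, a witness with cover A and support B
    gives the exponent p on B and p - 1 on A, so alpha_p <= p v + (p - 1) h
    ([frob_witness_of_witness]). Conversely, an exponent e counted by alpha_p is at
    least p on a set B and p - 1 on the union U of the minimal covers missing B.
    For one such cover A, the set B + (U - A) is a witness, of size |B| + |U| - h,
    so p (v + h) <= alpha_p + |U| ([witness_of_frob_witness]). As |U| <= N < p, both
    bounds together say that the ceiling of alpha_p / p is v + h. *)

Set Implicit Arguments.
Unset Strict Implicit.
Unset Printing Implicit Defensive.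

Import GRing.Theory Num.Theory.

(** * Exponents outside a monomial ideal, and vertex covers *)

Section Exponents.
Variable n : nat.
Implicit Types (u : seq 'X_{1..n}) (w m g e b : 'X_{1..n}) (A B : {set 'I_n}).
Local Open Scope set_scope.

(** Membership of x^w in the ideal generated by the monomials x^g, g in [u]. *)
Definition mon_mem u w : bool := has (fun g => (g <= w)%MM) u.

(** Membership of x^m in the ideal generated by the variables in [A]. *)
Definition hits A m : bool := [exists i in A, 0 < m i].

(** On monomials, this says that I : x^w is the ideal of the variables in [A]. *)
Definition witness u w A : Prop :=
  (forall i, i \in A -> mon_mem u (w + U_(i))) /\
  (forall m, mon_mem u (w + m) -> hits A m).

(** Minimality of the vertex cover [A] is expressed by giving each of its vertices
    a private edge, that is, one that meets [A] nowhere else. *)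
Definition min_cover u A : Prop :=
  (forall g, g \in u -> hits A g) /\
  (forall k, k \in A -> exists2 g, g \in u &
     0 < g k /\ forall k', k' \in A -> k' != k -> g k' = 0).

Lemma mon_memP u w :
  reflect (exists2 g, g \in u & forall i, g i <= w i) (mon_mem u w).
Proof.
apply: (iffP hasP) => -[g gu gw]; exists g => //; first exact/mnm_lepP.
exact/mnm_lepP.
Qed.

Lemma hitsP A m : reflect (exists2 i, i \in A & 0 < m i) (hits A m).
Proof. exact: (iffP exists_inP). Qed.

Lemma hitsU A i : hits A U_(i) = (i \in A).
Proof.
apply/hitsP/idP => [[j jA]|iA]; last by exists i; rewrite // mnm1E eqxx.
by rewrite mnm1E; case: eqP => // ->.
Qed.

Lemma mon_mem_le u w w' : (forall i, w i <= w' i) -> mon_mem u w -> mon_mem u w'.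
Proof.
move=> le /mon_memP[g gu gw]; apply/mon_memP; exists g => // i.
exact: leq_trans (gw i) (le i).
Qed.

Lemma witness_notin u w A : witness u w A -> ~~ mon_mem u w.
Proof.
case=> _ wA; apply/negP => wu; have: hits A 0%MM by apply: wA; rewrite addm0.
by case/hitsP => i _; rewrite mnm0E.
Qed.

(** Climbing from [lo] inside the box below [hi], one variable at a time, must
    stop before every further step stays in the box and outside the ideal. *)
Lemma maximal_outside u (lo hi : 'X_{1..n}) :
  ~~ mon_mem u lo -> (forall i, lo i <= hi i) ->
  exists w, [/\ forall i, lo i <= w i, forall i, w i <= hi i, ~~ mon_mem u w
              & forall i, w i < hi i -> mon_mem u (w + U_(i))].
Proof.
have [k] := ubnP (mdeg hi - mdeg lo).
elim: k lo => // k IH lo ltk loN lohi.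
have [/existsP[i /andP[lti iN]]|] :=
  boolP [exists i, (lo i < hi i) && ~~ mon_mem u (lo + U_(i))]; last first.
  rewrite negb_exists => /forallP H; exists lo; split=> // i lti.
  by have := H i; rewrite lti negbK.
have lohi' j : (lo + U_(i))%MM j <= hi j.
  rewrite mnmDE mnm1E; case: eqP => [<-|_]; first by rewrite addn1.
  by rewrite addn0.
have le_deg : mdeg (lo + U_(i)) <= mdeg hi.
  by rewrite !mdegE; apply: leq_sum => j _; apply: lohi'.
case: (IH (lo + U_(i))%MM) => // [|w [h1 h2 h3 h4]].
  by move: le_deg ltk; rewrite mdegD mdeg1; lia.
exists w; split=> // j; apply: leq_trans (h1 j).
by rewrite mnmDE leq_addr.
Qed.

(** Colon ideals grow with the monomial: a variable in I : x^w also lies in the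
    larger ideal I : x^w', which is the prime of [A]. *)
Lemma witness_ge u w w' A i :
  witness u w' A -> (forall i, w i <= w' i) -> mon_mem u (w + U_(i)) -> i \in A.
Proof.
case=> _ wA le wi; rewrite -hitsU; apply: wA; apply: mon_mem_le wi => j.
by rewrite !mnmDE leq_add2r.
Qed.

(** Every proper colon ideal I : x^w sits below an associated prime. A monomial
    outside I, maximal in a box that exceeds all exponents of the generators, is
    blocked either by the ideal, at the variables of the witness, or by the box,
    where multiplying by the variable any further cannot matter. *)
Lemma witness_above u w :
  ~~ mon_mem u w ->
  exists w' A, [/\ forall i, w i <= w' i, witness u w' A
                 & forall i g, i \notin A -> g \in u -> g i <= w' i].
Proof.
(* The maximum with w i keeps w inside the box. *)
move=> wN; pose hi := [multinom maxn (\max_(g <- u) g i) (w i) | i < n].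
have wle i : w i <= hi i by rewrite mnmE leq_maxr.
have [w' [le1 le2 w'N mx]] := maximal_outside wN wle.
pose A := [set i | mon_mem u (w' + U_(i))].
have big i g : i \notin A -> g \in u -> g i <= w' i.
  rewrite inE => iN gu; rewrite leqNgt; apply: contra iN => lt; apply: mx.
  apply: leq_trans lt _; rewrite mnmE leq_max; apply/orP; left.
  exact: leq_bigmax_seq.
exists w', A; split=> //; split=> [i|m]; first by rewrite inE.
case/mon_memP => g gu gle; apply: contraR w'N => mN; apply/mon_memP; exists g => // i.
have [iA|iA] := boolP (i \in A); last exact: big.
have := gle i; rewrite mnmDE; suff -> : m i = 0 by rewrite addn0.
apply/eqP; rewrite -leqn0 leqNgt; apply: contra mN => mi.
by apply/hitsP; exists i.
Qed.

(** A vertex without a private edge can be dropped from a cover. *)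
Lemma min_cover_sub u B :
  (forall g, g \in u -> hits B g) -> exists2 A : {set 'I_n}, A \subset B & min_cover u A.
Proof.
move=> covB; pose cov A := all (hits A) u.
have [|A /minsetP[/allP covA minA] AB] := @minset_exists _ cov B; first exact/allP.
exists A => //; split=> // k kA.
have [/hasP[g gu /andP[gk /forall_inP gA]]|] := boolP (has (fun g : 'X_{1..n} =>
   (0 < g k) && [forall (k' | k' \in A), (k' != k) ==> (g k' == 0)]) u).
  exists g => //; split=> // k' k'A ne; apply/eqP.
  by have := gA _ k'A; rewrite ne.
move=> /hasPn H; suff E : A :\ k = A by move: kA; rewrite -E !inE eqxx.
apply: minA; last exact: subsetDl.
apply/allP => g gu; have /hitsP[i iA gi] := covA _ gu.
have [ik|ik] := eqVneq i k; last by apply/hitsP; exists i; rewrite // !inE ik.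
rewrite -{k}ik in kA H *.
have := H _ gu; rewrite gi /= => /forall_inPn[k' k'A]; rewrite negb_imply.
case/andP => ne g0; apply/hitsP; exists k'; first by rewrite !inE ne.
by rewrite lt0n.
Qed.

End Exponents.

Section Squarefree.
Variables (n : nat) (G : seq 'X_{1..n}).
Hypothesis Gsq : forall g, g \in G -> forall k, g k <= 1.
Implicit Types (b e g : 'X_{1..n}) (A B : {set 'I_n}).
Local Open Scope set_scope.

(** If x^b is outside the ideal but x_k x^b is in it, the generator dividing the
    latter has exponent b_k + 1 at k, which squarefreeness forces to be 1. *)
Lemma witness_squarefree b A :
  witness G b A ->
  (forall k, k \in A -> b k = 0) /\
  (forall k, k \in A -> exists2 g, g \in G &
     0 < g k /\ forall k', k' != k -> g k' <= b k').
Proof.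
move=> wA; have bN := witness_notin wA; case: wA => w1 w2.
have key k : k \in A -> b k = 0 /\ exists2 g, g \in G &
     0 < g k /\ forall k', k' != k -> g k' <= b k'.
  move=> /w1/mon_memP[g gG gle].
  have out k' : k' != k -> g k' <= b k'.
    by move=> ne; have := gle k'; rewrite mnmDE mnm1E eq_sym (negbTE ne) addn0.
  have lt : b k < g k.
    rewrite ltnNge; apply: contra bN => le; apply/mon_memP; exists g => // k'.
    by have [->|] := eqVneq k' k; last exact: out.
  have := Gsq gG k; split; first lia.
  by exists g => //; split=> //; lia.
by split=> k /key[].
Qed.

Lemma witness_min_cover b A : witness G b A -> min_cover G A.
Proof.
move=> wA; have [b0 priv] := witness_squarefree wA; split=> [g gG|k kA].
  by case: wA => _; apply; apply/mon_memP; exists g => // i; rewrite mnmDE leq_addl.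
have [g gG [gk gle]] := priv _ kA; exists g => //; split=> // k' k'A ne.
by have := gle _ ne; rewrite b0 //; lia.
Qed.

Variables (h p : nat).
Hypothesis card_cover : forall A, min_cover G A -> #|A| = h.

Definition frob_gens : seq 'X_{1..n} := [seq (g *+ p)%MM | g <- G].

(** x^e lies in I^[p] : I but not in I^[p]. *)
Definition frob_witness e : Prop :=
  (forall g, g \in G -> mon_mem frob_gens (e + g)) /\ ~~ mon_mem frob_gens e.

Lemma frob_memP e :
  reflect (exists2 g, g \in G & forall i, g i * p <= e i) (mon_mem frob_gens e).
Proof.
apply: (iffP (mon_memP _ _)) => [[_ /mapP[g gG ->] le]|[g gG le]].
  by exists g => // i; have := le i; rewrite mulmnE.
by exists (g *+ p)%MM; [exact: map_f | move=> i; rewrite mulmnE].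
Qed.

(** Take exponent p on the support of [b] and p - 1 on the cover. An edge g hits
    the cover at some k, and x^g raises the exponent there from p - 1 to p; now the
    p-th power of the private generator of k divides. *)
Lemma frob_witness_of_witness b A : 1 < p -> witness G b A ->
  exists2 e, frob_witness e & mdeg e <= p * mdeg b + p.-1 * h.
Proof.
move=> p1 wA; have [b0 priv] := witness_squarefree wA.
have bN := witness_notin wA.
pose e := [multinom (p * (0 < b i) + p.-1 * (i \in A))%N | i < n].
exists e; last first.
  rewrite -(card_cover (witness_min_cover wA)) -sum1_card !mdegE.
  rewrite [in X in _ + X]big_mkcond /= !big_distrr /= -big_split /=.
  apply: leq_sum => i _; rewrite mnmE; case: (i \in A); case: (b i) => [|k]; lia.
split=> [g gG|]; last first.
  apply: contra bN => /frob_memP[g gG le]; apply/mon_memP; exists g => // i.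
  have := le i; rewrite mnmE; have := Gsq gG i.
  case: (posnP (b i)) => [->|]; last by lia.
  by case: (g i) => [|[|]] //; case: (i \in A); lia.
have /hitsP[k kA gk] : hits A g.
  by case: (witness_min_cover wA) => + _; apply.
have [g' g'G [g'k le]] := priv _ kA; apply/frob_memP; exists g' => // i.
rewrite mnmDE mnmE; have := Gsq g'G i.
have [->|ne] := eqVneq i k; first by rewrite kA b0 //; case: (g' k) => [|[|]]; lia.
have := le _ ne; case: (b i) => [|?]; case: (g' i) => [|[|]]; lia.
Qed.

(** With B the set where e >= p, each vertex i of a minimal cover missing B has
    e_i = p - 1: the private edge of i can supply only the one missing unit. Adding
    to B all vertices of the union U of these covers except those of one cover A0
    leaves A0 as the only minimal cover missing the set: a witness. The error
    term n bounds |U|. *)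
Lemma witness_of_frob_witness e : 0 < p -> frob_witness e ->
  exists b A, witness G b A /\ p * (mdeg b + h) <= mdeg e + n.
Proof.
move=> p0 [eF eN]; pose B := [set i | p <= e i].
have covB g : g \in G -> hits (~: B) g.
  move=> gG; apply: contraR eN => gB; apply/frob_memP; exists g => // i.
  have [iB|iB] := boolP (i \in B).
    by have := Gsq gG i; rewrite inE in iB; case: (g i) => [|[|]]; lia.
  case: (posnP (g i)) => [->//|gi]; case/negP: gB; apply/hitsP.
  by exists i; rewrite ?inE // inE in iB *.
have [A0 A0B mA0] := min_cover_sub covB.
(* U is the union of the minimal covers disjoint from B. *)
pose U := [set i | [exists A : {set 'I_n},
   [&& i \in A, A \subset ~: B & `[< min_cover G A >]]]].
have inU A i : min_cover G A -> A \subset ~: B -> i \in A -> i \in U.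
  move=> mA AB iA; rewrite inE; apply/existsP; exists A; rewrite iA AB.
  exact/asboolP.
have eU i : i \in U -> p.-1 <= e i < p.
  rewrite inE => /existsP[A /and3P[iA /subsetP AB /asboolP[cA /(_ _ iA)]]].
  case=> g gG [gi gA].
  have ltp j : j \in A -> e j < p by move=> /AB; rewrite !inE ltnNge.
  rewrite ltp // andbT; have /frob_memP[g' g'G le] := eF _ gG.
  have /hitsP[j jA g'j] := cA _ g'G.
  have := le j; rewrite mnmDE; have := ltp _ jA; have := Gsq gG j.
  have [ji|ne] := eqVneq j i.
    by subst j; case: (g' i) g'j => // q _; nia.
  by rewrite (gA _ jA ne); case: (g' j) g'j => // q _; nia.
have BU : [disjoint B & U].
  rewrite -setI_eq0; apply/eqP/setP => i; rewrite [RHS]inE in_setI.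
  by apply/negP => /andP[]; rewrite [_ \in B]inE => iB /eU/andP[_]; rewrite ltnNge iB.
have A0U : A0 \subset U by apply/subsetP => i; apply: inU.
pose B' := B :|: (U :\: A0).
exists (mesym1 B'), A0; split; last first.
  rewrite mdeg_mesym1 cardsU disjoint_setI0; last first.
    by apply: disjointWr BU; apply: subsetDl.
  rewrite cards0 subn0 cardsDS // (card_cover mA0).
  have := subset_leq_card A0U; rewrite (card_cover mA0) => hU.
  have : p * #|B| + p.-1 * #|U| <= mdeg e.
    rewrite -!sum1_card mdegE !big_distrr /= [leqLHS]addnC.
    rewrite big_mkcond [in X in _ + X]big_mkcond -big_split /=.
    apply: leq_sum => i _; have [iU|iU] := boolP (i \in U).
      have := eU _ iU; rewrite [_ \in B]inE; case: leqP; lia.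
    by rewrite [_ \in B]inE; case: (leqP p (e i)) => pe; rewrite ?muln1; lia.
  have hN : #|U| <= n by rewrite -[leqRHS]card_ord max_card.
  rewrite -addnA subnK // mulnDr; case: p p0 => // q _ /= hq.
  by rewrite (mulSn q #|U|) addnCA addnC leq_add.
split=> [i iA0|m].
  (* Otherwise some minimal cover misses B' and i; being part of U, it lies in
     A0 without i, and the private edge of i in A0 escapes it. *)
  have [/mon_memP//|] := boolP (mon_mem G (mesym1 B' + U_(i))).
  move=> /mon_memP N; exfalso.
  have cov g : g \in G -> hits (~: (i |: B')) g.
    move=> gG; apply: contra_notT N => gN; exists g => // j.
    rewrite mnmDE mnmE mnm1E; have := Gsq gG j.
    case: (posnP (g j)) => [->//|gj].
    have : j \notin ~: (i |: B').
      by apply: contra gN => jN; apply/hitsP; exists j.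
    by rewrite inE negbK in_setU1 eq_sym; case: (i == j); case: (j \in B'); lia.
  have [A sA mA] := min_cover_sub cov.
  have AB : A \subset ~: B.
    apply: subset_trans sA _; rewrite setCS.
    by apply: subset_trans (subsetUr _ _); apply: subsetUl.
  have AA0 j : j \in A -> (j \in A0) && (j != i).
    move=> jA; have := subsetP sA _ jA; have jU := inU _ _ mA AB jA.
    rewrite in_setC in_setU1 in_setU in_setD jU andbT.
    by rewrite !negb_or negbK; case/and3P => -> _ ->.
  have [g gG [gi gA0]] := mA0.2 _ iA0.
  have /hitsP[j /AA0/andP[jA ne]] := mA.1 _ gG.
  by rewrite gA0.
case/mon_memP => g gG le; have /hitsP[i iA gi] := mA0.1 _ gG.
apply/hitsP; exists i => //; have := le i; rewrite mnmDE mnmE.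
suff -> : (i \in B') = false by lia.
by rewrite !inE iA /= orbF; have := subsetP A0B _ iA; rewrite !inE => /negbTE.
Qed.

End Squarefree.

(** * Combinatorics of the polarization *)

Section Polarize.
Variables (n : nat) (u : seq 'X_{1..n}).
Local Notation N := (pol_nvars u).
Implicit Types (w m g : 'X_{1..n}) (A : {set 'I_n}) (k : 'I_N).
Local Open Scope set_scope.

(** A variable of the polarization ring is the pair of its index i and its level
    j; levels start at 0. *)
Definition pol_decode k : pol_index u := enum_val (k : 'I_#|{: pol_index u}|).
Definition var_idx k : 'I_n := tag (pol_decode k).
Definition var_lvl k : nat := tagged (pol_decode k).

Definition pol_encode (i : 'I_n) (j : 'I_(max_exp u i)) : 'I_N :=
  enum_rank (Tagged (fun i => 'I_(max_exp u i)) j).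

Lemma var_idx_encode (i : 'I_n) (j : 'I_(max_exp u i)) : var_idx (pol_encode j) = i.
Proof. by rewrite /var_idx /pol_decode enum_rankK. Qed.

Lemma var_lvl_encode (i : 'I_n) (j : 'I_(max_exp u i)) : var_lvl (pol_encode j) = j.
Proof. by rewrite /var_lvl /pol_decode enum_rankK. Qed.

Lemma pol_var_ex (i : 'I_n) j :
  j < max_exp u i -> exists2 k, var_idx k = i & var_lvl k = j.
Proof.
move=> ltj; exists (pol_encode (Ordinal ltj)); first exact: var_idx_encode.
exact: var_lvl_encode.
Qed.

Lemma pol_var_inj k k' : var_idx k = var_idx k' -> var_lvl k = var_lvl k' -> k = k'.
Proof.
rewrite /var_idx /var_lvl => ei el; apply: (@enum_val_inj _ {: pol_index u}).
rewrite -/(pol_decode k) -/(pol_decode k'); move: ei el.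
case: (pol_decode k) (pol_decode k') => [i j] [i' j'] /= ei; case: i' / ei j' => j'.
by move=> /val_inj ->.
Qed.

Lemma max_exp_ge g (i : 'I_n) : g \in u -> g i <= max_exp u i.
Proof. by move=> gu; apply: leq_bigmax_seq. Qed.

Definition pol_exp m : 'X_{1..N} := [multinom (var_lvl k < m (var_idx k) : nat) | k < N].

Lemma pol_expE m k : pol_exp m k = (var_lvl k < m (var_idx k)).
Proof. by rewrite mnmE. Qed.

Definition pol_gens : seq 'X_{1..N} := map pol_exp u.

Lemma pol_gens_squarefree (g : 'X_{1..N}) : g \in pol_gens -> forall k, g k <= 1.
Proof. by case/mapP => m _ -> k; rewrite pol_expE leq_b1. Qed.

Lemma pol_memP (b : 'X_{1..N}) :
  reflect (exists2 g, g \in u & forall k, (var_lvl k < g (var_idx k)) -> 0 < b k)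
          (mon_mem pol_gens b).
Proof.
apply: (iffP (mon_memP _ _)) => [[_ /mapP[g gu ->] le]|[g gu le]].
  by exists g => // k; have := le k; rewrite pol_expE => + lt; rewrite lt.
exists (pol_exp g); first exact: map_f.
by move=> k; rewrite pol_expE; case: (ltnP (var_lvl k)) => // /le.
Qed.

Definition levels (i : 'I_n) c : {set 'I_N} :=
  [set k | (var_idx k == i) && (var_lvl k < c)].

Lemma card_levels (i : 'I_n) c : #|levels i c| = minn c (max_exp u i).
Proof.
pose f (j : 'I_(minn c (max_exp u i))) : 'I_N :=
  pol_encode (widen_ord (geq_minr _ _) j).
have fi : injective f.
  move=> j j' /(congr1 var_lvl); rewrite !var_lvl_encode => /= jj'; exact: val_inj.
rewrite -[RHS]card_ord -(card_imset _ fi); apply: eq_card => k; rewrite inE.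
apply/andP/imsetP => [[/eqP ki lt]|[j _ ->]]; last first.
  rewrite var_idx_encode var_lvl_encode; split=> //=.
  by apply: leq_trans (ltn_ord j) _; apply: geq_minl.
have lt2 : var_lvl k < max_exp u i by rewrite -ki ltn_ord.
have lt3 : var_lvl k < minn c (max_exp u i) by rewrite leq_min lt.
exists (Ordinal lt3) => //; apply: pol_var_inj; first by rewrite var_idx_encode.
by rewrite var_lvl_encode.
Qed.

Lemma mdeg_by_var (b : 'X_{1..N}) :
  mdeg b = \sum_(i < n) \sum_(k | var_idx k == i) b k.
Proof. by rewrite mdegE (partition_big var_idx predT). Qed.

(** The polarization of x^w works, with the variables x_{i,w_i}, counting levels
    from 0, for i in [A]: these are the ones that polarizing x_i x^w adds. *)
Lemma witness_polarize w A : witness u w A ->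
  exists b (A' : {set 'I_N}), witness pol_gens b A' /\ mdeg b <= mdeg w.
Proof.
move=> wA; have wN := witness_notin wA; case: wA => w1 w2.
exists (pol_exp w), [set k | (var_idx k \in A) && (var_lvl k == w (var_idx k))].
split; last first.
  rewrite mdeg_by_var mdegE; apply: leq_sum => i _.
  apply: leq_trans (geq_minl _ (max_exp u i)); rewrite -card_levels -sum1_card.
  rewrite big_mkcond [leqRHS]big_mkcond; apply: leq_sum => k _ /=.
  by rewrite inE pol_expE; case: eqP => // ->; case: ltnP.
split=> [k|m].
  rewrite inE => /andP[/w1/mon_memP[g gu le] /eqP lk]; apply/pol_memP; exists g => // k'.
  have := le (var_idx k'); rewrite !mnmDE !mnm1E pol_expE.
  case: eqP => [e|_] h1 h2; last first.
    by rewrite (leq_trans h2) // -[w _]addn0.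
  case: (ltngtP (var_lvl k') (w (var_idx k'))) => //=; first by lia.
  by move=> e2; rewrite (_ : k = k') ?eqxx //; apply: pol_var_inj => //; rewrite lk e2 e.
move=> /pol_memP[g gu le]; apply/hitsP.
(* x^M is the part of x^g outside A; as A witnesses w, x^(w + M) is not in I. *)
pose M := [multinom (if i \in A then 0 else g i) | i < n].
have [i] : exists i, w i + M i < g i.
  apply/existsP; rewrite -[X in is_true X]negbK negb_exists; apply/negP => /forallP H.
  have /hitsP[i iA] : hits A M.
    by apply: w2; apply/mon_memP; exists g => // i; rewrite mnmDE leqNgt H.
  by rewrite mnmE iA.
rewrite mnmE; case: ifP => [iA|_]; last by rewrite ltnNge leq_addl.
rewrite addn0 => lt; have [k ki kl] := pol_var_ex (leq_trans lt (max_exp_ge i gu)).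
exists k; first by rewrite inE ki kl iA eqxx.
by have := le k; rewrite ki kl lt mnmDE pol_expE ki kl ltnn => /(_ isT).
Qed.

(** A polarized generator containing x_{i,j} contains every x_{i,j'} with j' < j,
    so of two vertices with the same index the upper one has no private edge. *)
Lemma min_cover_levels (A : {set 'I_N}) : min_cover pol_gens A ->
  exists c : 'I_n -> nat, forall k, k \in A -> c (var_idx k) = var_lvl k.
Proof.
move=> [cA pA].
exists (fun i => if [pick k in A | var_idx k == i] is Some k then var_lvl k else 0).
move=> k kA.
case: pickP => [k'|/(_ k)]; last by rewrite kA eqxx.
case/andP => k'A /eqP e.
suff aux x y : x \in A -> y \in A -> var_idx x = var_idx y -> var_lvl x <= var_lvl y.
  by apply/eqP; rewrite eqn_leq !aux.
move=> xA yA exy; rewrite leqNgt; apply/negP => lt.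
have [_ /mapP[g gu ->] [gx gA]] := pA _ xA.
have /gA : y != x by apply: contraTneq lt => ->; rewrite ltnn.
move=> /(_ yA); move: gx; rewrite !pol_expE exy lt0b => gx.
by rewrite (ltn_trans lt gx).
Qed.

Variable h : nat.
Hypothesis card_ass : forall w A, witness u w A -> #|A| = h.

(** If the cover has the levels c_i on the index set A', the exponent equal to c_i
    on A' and large elsewhere is outside I. Any witness above it has exactly the
    variables A': outside A' the exponents are already too large to matter, and a
    missing i in A' would let the private generator of i divide. *)
Lemma card_min_cover (A : {set 'I_N}) :
  min_cover pol_gens A -> #|var_idx @: A| = h /\ #|A| = h.
Proof.
move=> mA; have [c cE] := min_cover_levels mA; case: (mA) => covA privA.
have vinj : {in A &, injective var_idx}.
  by move=> k k' kA k'A e; apply: pol_var_inj => //; rewrite -!cE // e.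
suff H : #|var_idx @: A| = h by split; rewrite // -H card_in_imset.
pose w := [multinom (if i \in var_idx @: A then c i else max_exp u i) | i < n].
have wN : ~~ mon_mem u w.
  apply/negP => /mon_memP[g gu le].
  have /hitsP[k kA] := covA _ (map_f pol_exp gu); rewrite pol_expE lt0b.
  by have := le (var_idx k); rewrite mnmE imset_f // cE // leqNgt => /negP H /H.
have [w' [A' [lew wA' big]]] := witness_above wN.
rewrite -(card_ass wA'); apply: eq_card => i.
have w'N := witness_notin wA'.
apply/idP/idP => [|iA'].
  case/imsetP => k kA ->{i}; apply: contraR w'N => iN.
  have [_ /mapP[g gu ->] [gk gA]] := privA _ kA.
  apply/mon_memP; exists g => // i'.
  have [->|ne] := eqVneq i' (var_idx k); first exact: big.
  apply: leq_trans (lew i'); rewrite mnmE.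
  case: imsetP => [[k' k'A e]|_]; last exact: max_exp_ge.
  have := gA _ k'A; rewrite e pol_expE cE // leqNgt; case: ltnP => // lt.
  by move=> /(_ (contra_neq _ ne)) H; have // : 1 = 0 by apply: H => ek; rewrite e ek.
apply: contraR w'N => iN; case: (wA') => /(_ _ iA') /mon_memP[g gu le] _.
apply/mon_memP; exists g => // i'; have := le i'; rewrite mnmDE mnm1E.
case: eqP => [<-|]; last by rewrite addn0.
by move=> _; apply: leq_trans (lew i); rewrite mnmE (negbTE iN) max_exp_ge.
Qed.

(** Let cnt_i count the levels of i in the support of b. On the index set A' of the
    cover, cnt_i may exceed what keeps the monomial outside I, so one takes instead
    a maximal exponent between the cover levels and cnt. Its colon ideal contains
    the variables of A'; were it larger, some associated prime would contain A' and
    one more variable, against the common size h. *)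
Lemma witness_depolarize (b : 'X_{1..N}) (A : {set 'I_N}) : witness pol_gens b A ->
  exists w A', witness u w A' /\ mdeg w <= mdeg b.
Proof.
move=> wA; have [b0 priv] := witness_squarefree pol_gens_squarefree wA.
have mA := witness_min_cover pol_gens_squarefree wA.
have [cardA' _] := card_min_cover mA; have [c cE] := min_cover_levels mA.
case: (mA) => covA _; set A' := var_idx @: A in cardA'.
pose supp i := [set k | (var_idx k == i) && (0 < b k)].
pose cnt := [multinom #|supp i| | i < n].
pose lo := [multinom (if i \in A' then c i else cnt i) | i < n].
have priv' k : k \in A -> exists2 g, g \in u & var_lvl k < g (var_idx k) /\
    forall k', k' != k -> var_lvl k' < g (var_idx k') -> 0 < b k'.
  case/priv => _ /mapP[g gu ->] [gk le]; exists g => //.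
  move: gk; rewrite pol_expE lt0b => gk; split=> // k' /le.
  by rewrite pol_expE => + lt; rewrite lt.
have cntU g i : g \in u -> (forall k, var_idx k = i -> var_lvl k < g i -> 0 < b k) ->
    g i <= cnt i.
  move=> gu H; rewrite mnmE -(minn_idPl (max_exp_ge i gu)) -card_levels.
  apply/subset_leq_card/subsetP => k; rewrite !inE => /andP[/eqP e lt].
  by rewrite e eqxx H.
(* The vertex k of the cover is itself absent from b, whence the successor. *)
have cntA g k : g \in u -> k \in A ->
    (forall k', k' != k -> var_lvl k' < g (var_idx k') -> 0 < b k') ->
    g (var_idx k) <= (cnt (var_idx k)).+1.
  move=> gu kA H; rewrite mnmE -(minn_idPl (max_exp_ge _ gu)) -card_levels.
  apply: leq_trans (_ : #|k |: supp (var_idx k)| <= _); last first.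
    by rewrite cardsU1; case: (_ \notin _); rewrite ?add0n ?add1n.
  apply/subset_leq_card/subsetP => k'; rewrite !inE => /andP[/eqP e lt].
  by case: eqVneq => //= ne; rewrite e eqxx H // e.
have cnt_deg : mdeg cnt <= mdeg b.
  rewrite mdegE mdeg_by_var; apply: leq_sum => i _; rewrite mnmE -sum1_card.
  rewrite big_mkcond [leqRHS]big_mkcond; apply: leq_sum => k _ /=.
  by rewrite inE; case: eqP => //= _; case: (b k).
have lohi i : lo i <= cnt i.
  rewrite mnmE; case: imsetP => // -[k kA ->]; rewrite cE //.
  have [g gu [gk gle]] := priv' _ kA.
  by rewrite -ltnS; apply: leq_trans gk _; apply: cntA.
have loN : ~~ mon_mem u lo.
  apply/negP => /mon_memP[g gu le].
  have /hitsP[k kA] := covA _ (map_f pol_exp gu); rewrite pol_expE lt0b.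
  by have := le (var_idx k); rewrite mnmE imset_f // cE // leqNgt => /negP H /H.
have [w [lew wle wN wmax]] := maximal_outside loN lohi.
exists w, A'; split; last first.
  by apply: leq_trans cnt_deg; rewrite !mdegE; apply: leq_sum.
have w1 i : i \in A' -> mon_mem u (w + U_(i)).
  move=> iA'; have [/wmax//|ge] := ltnP (w i) (cnt i).
  case/imsetP: iA' ge => k kA -> ge.
  have [g gu [gk gle]] := priv' _ kA; apply/mon_memP; exists g => // i'.
  rewrite mnmDE mnm1E; case: eqVneq => [<-|ne].
    by rewrite addn1; apply: leq_trans (cntA _ _ gu kA gle) _.
  rewrite addn0; apply: leq_trans (lew i'); rewrite mnmE.
  case: imsetP => [[k' k'A e]|_]; last first.
    by apply: cntU => // k' e lt; apply: gle; [apply: contra_neq ne => <- | rewrite e].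
  rewrite e cE // leqNgt; apply/negP => lt.
  have := gle k'; rewrite b0 // lt; case: eqVneq => [ek|_ /(_ isT isT)//].
  by rewrite e ek eqxx in ne.
split=> // m wm; have [//|mN] := boolP (hits A' m); exfalso.
(* Climbing from w towards w + m gets stuck at a variable i0 of m, outside A'. *)
have [] := @maximal_outside _ u w (w + m) wN; first by move=> i; rewrite mnmDE leq_addr.
move=> w' [lew' w'le w'N w'max].
have [i0 lt0] : exists i, w' i < (w + m)%MM i.
  apply/existsP; apply: contraR w'N; rewrite negb_exists => /forallP H.
  by apply: mon_mem_le wm => i; rewrite leqNgt H.
have i0N : i0 \notin A'.
  apply: contra mN => i0A; apply/hitsP; exists i0 => //.
  by have := lew' i0; move: lt0; rewrite mnmDE; lia.
have [w'' [A'' [lew'' wA'' _]]] := witness_above w'N.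
have : i0 |: A' \subset A''.
  apply/subsetP => i; rewrite in_setU1 => /orP[/eqP->|iA].
    exact: witness_ge wA'' lew'' (w'max _ lt0).
  apply: witness_ge wA'' (fun i => leq_trans (lew' i) (lew'' i)) (w1 _ iA).
by move/subset_leq_card; rewrite cardsU1 i0N cardA' (card_ass wA'') add1n ltnn.
Qed.

End Polarize.

(** * Ideals generated by monomials *)

From mathcomp Require Import classical_sets.

Local Open Scope classical_set_scope.
Local Open Scope ring_scope.

Section IdealGen.
Variable R : comNzRingType.
Implicit Types (J : set R) (G : set R).

Lemma ideal_gen_ideal G : is_ideal (ideal_gen G).
Proof.
split=> [M [[M0 _ _] _]//|x y xG yG M MG|a x xG M MG].
  by case: (MG) => -[_ MD _] _; apply: MD; [apply: xG | apply: yG].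
by case: (MG) => -[_ _ MM] _; apply: MM; apply: xG.
Qed.

Lemma ideal_gen_sub G : G `<=` ideal_gen G.
Proof. exact: sub_gen_smallest. Qed.

Lemma ideal_gen_min J G : is_ideal J -> G `<=` J -> ideal_gen G `<=` J.
Proof. exact: smallest_sub. Qed.

Lemma ideal_sum J (T : eqType) (r : seq T) (F : T -> R) :
  is_ideal J -> (forall i, i \in r -> J (F i)) -> J (\sum_(i <- r) F i).
Proof.
move=> [J0 JD _] JF; rewrite big_seq; by elim/big_ind: _ => // [x y|i /JF//]; apply: JD.
Qed.

Lemma ideal_prime_prod J (T : eqType) (r : seq T) (F : T -> R) :
  is_prime_ideal J -> J (\prod_(i <- r) F i) -> exists2 i, i \in r & J (F i).
Proof.
move=> [[_ J1] Jp]; elim: r => [|i r IH]; rewrite ?big_nil // big_cons.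
case/Jp => [|/IH[j jr Jj]]; first by exists i; rewrite // mem_head.
by exists j; rewrite // inE jr orbT.
Qed.

Lemma ideal_prime_exp J (x : R) k :
  is_prime_ideal J -> J (x ^+ k) -> (0 < k)%N /\ J x.
Proof.
move=> Jp; case: (Jp) => -[_ J1] Jm; elim: k => [|k IH]; rewrite ?expr0 // exprS.
by case/Jm => // /IH[].
Qed.

Lemma colon1E J f g : colon J [set f] g <-> J (g * f).
Proof. by split=> [/(_ f)|h _ ->//]; apply. Qed.

End IdealGen.

Section MonomialIdeal.
Variables (n : nat) (K : fieldType).
Implicit Types (u : seq 'X_{1..n}) (w m g : 'X_{1..n}) (A : {set 'I_n}).
Implicit Types (f : {mpoly K[n]}) (P : set {mpoly K[n]}).

Lemma msupp_mulX f w m : (m \in msupp (f * 'X_[w])) =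
  has (fun k => m == w + k)%MM (msupp f).
Proof.
rewrite (perm_mem (msuppMX f w)); apply/mapP/hasP => -[k kf].
  by move=> ->; exists k.
by move/eqP ->; exists k.
Qed.

Lemma mem_msupp_mulX f w k : k \in msupp f -> (w + k)%MM \in msupp (f * 'X_[w]).
Proof. by move=> kf; rewrite msupp_mulX; apply/hasP; exists k. Qed.

(** The polynomials all of whose monomials are multiples of generators form an
    ideal. *)
Lemma monomial_idealP u f :
  monomial_ideal u f <-> forall m, m \in msupp f -> mon_mem u m.
Proof.
have idJ := ideal_gen_ideal [set f : {mpoly K[n]} | exists2 m, m \in u & f = 'X_[m]].
split=> [|H].
  apply: (@ideal_gen_min _ [set f | forall m, m \in msupp f -> mon_mem u m]);
    last move=> _ [g gu ->] m.
    split=> [m|x y hx hy m|a x hx m]; first by rewrite msupp0.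
      by move/msuppD_le; rewrite mem_cat => /orP[/hx|/hy].
    case/msuppM_le/allpairsP => -[m1 m2] /= [_ /hx hm ->].
    by apply: mon_mem_le hm => i; rewrite mnmDE leq_addl.
  by move/mem_msuppXP <-; apply/mon_memP; exists g.
rewrite [f]mpolyE; apply: ideal_sum => // m /H /mon_memP[g gu gm].
rewrite -(submK (introT mnm_lepP gm)) mpolyXD scalerAl.
by case: idJ => _ _; apply; apply: ideal_gen_sub; exists g.
Qed.

Lemma monomial_idealX u w : monomial_ideal u ('X_[w] : {mpoly K[n]}) <-> mon_mem u w.
Proof.
split=> [/monomial_idealP|H]; first by apply; rewrite msuppX mem_head.
by apply/monomial_idealP => m /mem_msuppXP <-.
Qed.

Lemma proper_mon_mem0 u : is_proper_ideal (monomial_ideal u : set {mpoly K[n]}) ->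
  ~~ mon_mem u 0%MM.
Proof. by case=> _ N; apply/negP => /monomial_idealX; rewrite mpolyX0. Qed.

Definition var_prime A : set {mpoly K[n]} :=
  [set f | forall m, m \in msupp f -> hits A m].

(** Setting the variables of [A] to 0, whose kernel is the prime of [A]. *)
Definition kill_vars A : {mpoly K[n]} -> {mpoly K[n]} :=
  comp_mpoly [tuple (if i \in A then 0 else 'X_i) | i < n].

Lemma kill_varsX A m : kill_vars A 'X_[m] = if hits A m then 0 else 'X_[m].
Proof.
rewrite /kill_vars comp_mpolyX; case: ifPn => [/hitsP[i iA mi]|mN].
  by rewrite (bigD1 i) //= tnth_mktuple iA expr0n eqn0Ngt mi mul0r.
rewrite [in RHS]mpolyXE_id; apply: eq_bigr => i _; rewrite tnth_mktuple.
case: ifP => // iA; case: (posnP (m i)) => [->|mi]; first by rewrite !expr0.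
by case/negP: mN; apply/hitsP; exists i.
Qed.

Lemma mcoeff_kill_vars A f k : (kill_vars A f)@_k = if hits A k then 0 else f@_k.
Proof.
rewrite /kill_vars {1}[f]mpolyE (raddf_sum (comp_mpoly _)) (raddf_sum (mcoeff k)) /=.
transitivity (\sum_(m <- msupp f) if hits A k then 0 else (f@_m *: 'X_[m])@_k).
  apply: eq_bigr => m _; rewrite comp_mpolyZ !mcoeffZ -/(kill_vars A 'X_[m]) kill_varsX.
  have [<-|ne] := eqVneq m k; first by case: ifP; rewrite ?mcoeff0 ?mulr0.
  by case: ifP; rewrite ?mcoeff0 mcoeffX (negbTE ne) mulr0 if_same.
case: ifP => _; first by rewrite big1.
by rewrite [in RHS](mpolyE f) [RHS]raddf_sum.
Qed.

(** As the kernel of a morphism to a domain, [var_prime] is a prime ideal. *)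
Lemma var_primeE A f : var_prime A f <-> kill_vars A f = 0.
Proof.
split=> [H|H m mf].
  apply/mpolyP => k; rewrite mcoeff0 mcoeff_kill_vars; case: ifPn => // kN.
  by apply: memN_msupp_eq0; apply: contra kN => /H.
move: mf; rewrite mcoeff_msupp; apply: contraR => mN.
by have := mcoeff_kill_vars A f m; rewrite H mcoeff0 (negbTE mN) => <-.
Qed.

Lemma var_primeX A i : var_prime A 'X_i <-> i \in A.
Proof.
split=> [/(_ U_(i)%MM)|iA m /mem_msuppXP <-]; last by rewrite hitsU.
by rewrite msuppX mem_head hitsU => ->.
Qed.

Lemma var_prime_prime A : is_prime_ideal (var_prime A).
Proof.
split; first split; first split.
- by apply/var_primeE; rewrite /kill_vars raddf0.
- move=> x y /var_primeE hx /var_primeE hy; apply/var_primeE.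
  by rewrite /kill_vars raddfD /= -!/(kill_vars _ _) hx hy addr0.
- move=> a x /var_primeE hx; apply/var_primeE.
  by rewrite /kill_vars rmorphM /= -!/(kill_vars _ _) hx mulr0.
- by move/var_primeE/eqP; rewrite /kill_vars comp_mpoly1 oner_eq0.
move=> x y /var_primeE/eqP; rewrite /kill_vars rmorphM mulf_eq0 => /orP[]/eqP h.
  by left; apply/var_primeE.
by right; apply/var_primeE.
Qed.

Lemma var_primeS (A B : {set 'I_n}) : A \subset B -> var_prime A `<=` var_prime B.
Proof.
move=> /fintype.subsetP AB f fA m /fA /hitsP[i /AB iB mi].
by apply/hitsP; exists i.
Qed.

Lemma witness_colon u w A :
  witness u w A -> colon (monomial_ideal u) [set 'X_[w]] = var_prime A.
Proof.
move=> [w1 w2]; apply/seteqP; split=> f.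
  move/colon1E/monomial_idealP => H m mf; apply: w2; apply: H.
  exact: mem_msupp_mulX.
move=> fA; apply/colon1E/monomial_idealP => m; rewrite msupp_mulX.
case/hasP => k /fA /hitsP[i iA ki] /eqP ->.
apply: mon_mem_le (w1 i iA) => j; rewrite !mnmDE leq_add2l mnm1E.
by case: eqP => // <-.
Qed.

Lemma witness_Ass u w A : witness u w A -> Ass (monomial_ideal u) (var_prime A).
Proof.
by move=> wA; split; [exact: var_prime_prime | exists 'X_[w]; exact: witness_colon].
Qed.

(** Let A be the set of variables in P. All of them carry every monomial of f into
    the ideal. If no monomial x^w of f were a witness for A, each would have a
    multiplier free of A taking it into the ideal; the product of these multipliers
    takes f into it, hence lies in the prime P, and so does one of its variables. *)
Lemma colon_witness u P f :
  is_prime_ideal P -> colon (monomial_ideal u) [set f] = P ->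
  exists2 w, w \in msupp f & exists A, witness u w A.
Proof.
move=> Pp PE; pose A := [set i | `[< P 'X_i >]]%SET.
have w1 w i : w \in msupp f -> i \in A -> mon_mem u (w + U_(i)).
  move=> wf; rewrite inE => /asboolP; rewrite -PE => /colon1E/monomial_idealP; apply.
  by rewrite mulrC addmC; exact: mem_msupp_mulX.
apply: contrapT => N.
have /choice[mw mwP] w : exists m, w \in msupp f -> mon_mem u (w + m) && ~~ hits A m.
  have [wf|] := boolP (w \in msupp f); last by exists 0%MM.
  apply: contrapT => N2; apply: N; exists w => //; exists A; split=> [i|m wm].
    exact: w1.
  by apply: contrapT => /negP mN; apply: N2; exists m; rewrite wm.
pose M := (\sum_(w <- msupp f) mw w)%MM.
have : P 'X_[M].
  rewrite -PE; apply/colon1E/monomial_idealP => m; rewrite mulrC msupp_mulX.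
  case/hasP => w wf /eqP ->; have /andP[H _] := mwP _ wf.
  apply: mon_mem_le H => i; rewrite !mnmDE addnC leq_add2r mnm_sumE.
  by rewrite (bigD1_seq w) //= ?leq_addr.
rewrite /M (big_morph _ (@mpolyXD n K) (@mpolyX0 n K)).
move=> /(ideal_prime_prod Pp)[w /mwP/andP[_ mN]].
rewrite mpolyXE_id => /(ideal_prime_prod Pp)[i _ /(ideal_prime_exp Pp)[mi Pi]].
by case/negP: mN; apply/hitsP; exists i; rewrite // inE; apply/asboolP.
Qed.

Lemma is_vnumberE u v : is_vnumber (monomial_ideal u : set {mpoly K[n]}) v <->
  is_min [set mdeg w | w in [set w | exists A, witness u w A]] v.
Proof.
rewrite /is_vnumber; suff -> : [set d | exists f : {mpoly K[n]},
            f \is d.-homog /\ exists P, Ass (monomial_ideal u) P /\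
              colon (monomial_ideal u) [set f] = P] =
   [set mdeg w | w in [set w | exists A, witness u w A]] by [].
apply/seteqP; split=> d /=.
  case=> f [/dhomogP fd [P [[Pp _] PE]]].
  by have [w wf wA] := colon_witness Pp PE; exists w => //; apply: fd.
case=> w [A wA] <-; exists 'X_[w]; split; first by rewrite dhomogX.
by exists (var_prime A); split; [exact: witness_Ass wA | exact: witness_colon].
Qed.

End MonomialIdeal.

Section Frobenius.
Variables (n : nat) (F : fieldType) (p : nat).
Hypothesis charF : p \in [pchar F].
Implicit Types (u : seq 'X_{1..n}).

(** The Frobenius is additive, so it is enough to raise the terms of a
    polynomial to the power p. *)
Lemma frobenius_power_monomial u :
  frobenius_power p (monomial_ideal u : set {mpoly F[n]}) =
  monomial_ideal (frob_gens u p).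
Proof.
have idJ := ideal_gen_ideal
  [set f : {mpoly F[n]} | exists2 m, m \in frob_gens u p & f = 'X_[m]].
apply/seteqP; split; apply: ideal_gen_min; try exact: ideal_gen_ideal.
  move=> _ [a /monomial_idealP au ->].
  have charR : p \in [pchar {mpoly F[n]}].
    by rewrite (rmorph_pchar (@mpolyC n F)).
  rewrite [a]mpolyE -[_ ^+ p]/(pFrobenius_aut charR _) rmorph_sum /=.
  apply: ideal_sum => // m /au /mon_memP[g gu gm].
  rewrite pFrobenius_autE exprZn -mul_mpolyC.
  case: (idJ) => _ _; apply; apply/monomial_idealP => m'.
  rewrite mpolyXn => /mem_msuppXP <-; apply/frob_memP; exists g => // i.
  by rewrite mulmnE leq_mul2r gm orbT.
move=> _ [_ /mapP[g gu ->] ->]; apply: ideal_gen_sub.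
exists 'X_[g]; last by rewrite mpolyXn.
by apply/monomial_idealX/mon_memP; exists g.
Qed.

Lemma is_alphaE u a : is_alpha p (monomial_ideal u : set {mpoly F[n]}) a <->
  is_min [set mdeg e | e in [set e | frob_witness u p e]] a.
Proof.
rewrite /is_alpha frobenius_power_monomial.
suff -> : [set d | exists f : {mpoly F[n]}, f \is d.-homog /\
     (colon (monomial_ideal (frob_gens u p)) (monomial_ideal u) `\`
      monomial_ideal (frob_gens u p)) f] =
   [set mdeg e | e in [set e | frob_witness u p e]] by [].
apply/seteqP; split=> d /=.
  case=> f [/dhomogP fd [fc fN]].
  have [e ef eN] : exists2 e, e \in msupp f & ~~ mon_mem (frob_gens u p) e.
    apply: contrapT => N; apply: fN; apply/monomial_idealP => m mf.
    by apply: contrapT => /negP mN; apply: N; exists m.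
  exists e; last exact: fd; split=> // g gu.
  have /fc/monomial_idealP : monomial_ideal u ('X_[g] : {mpoly F[n]}).
    by apply/monomial_idealX/mon_memP; exists g.
  by apply; rewrite addmC; exact: mem_msupp_mulX.
case=> e [e1 e2] <-; exists 'X_[e]; split; first by rewrite dhomogX.
split; last by move/monomial_idealX; apply/negP.
move=> x /monomial_idealP xu; apply/monomial_idealP => m; rewrite mulrC msupp_mulX.
case/hasP => k /xu /mon_memP[g gu gk] /eqP ->.
by apply: mon_mem_le (e1 _ gu) => i; rewrite !mnmDE leq_add2l.
Qed.

End Frobenius.

Section PolarizationIdeal.
Variables (n : nat) (u : seq 'X_{1..n}) (K : fieldType).

Lemma polarizeE m : m \in u -> polarize u K m = 'X_[pol_exp u m].
Proof.
move=> mu; rewrite /polarize.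
under eq_bigr => i _ do rewrite /pol_var -(big_morph _ (@mpolyXD _ K) (@mpolyX0 _ K)).
rewrite -(big_morph _ (@mpolyXD _ K) (@mpolyX0 _ K)); congr 'X_[_].
apply/mnmP => k; rewrite pol_expE !mnm_sumE.
have E i (j : 'I_(max_exp u i)) :
  enum_rank (Tagged (fun i => 'I_(max_exp u i)) j) = pol_encode j by [].
under eq_bigr => i _.
  rewrite mnm_sumE; under eq_bigr => j _ do rewrite E mnm1E.
  over.
rewrite (bigD1 (var_idx k)) //= [X in (_ + X)%N]big1 ?addn0 => [|i ne]; last first.
  by rewrite big1 // => j _; case: eqP => // e; rewrite -e var_idx_encode eqxx in ne.
have lk : (var_lvl k < max_exp u (var_idx k))%N by apply: ltn_ord.
rewrite big_mkcond (bigD1 (Ordinal lk)) //= big1 ?addn0 => [|j ne].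
  have -> : pol_encode (Ordinal lk) = k.
    by apply: pol_var_inj; rewrite ?var_idx_encode ?var_lvl_encode.
  by rewrite eqxx; case: ifP.
case: ifP => // _; case: eqP => // e; case/eqP: ne; apply: val_inj.
by rewrite /= -(var_lvl_encode j) e.
Qed.

Lemma polarizationE : polarization u K = monomial_ideal (pol_gens u).
Proof.
rewrite /polarization /monomial_ideal; congr ideal_gen; apply/seteqP; split=> f.
  by case=> m mu ->; exists (pol_exp u m); [exact: map_f | rewrite polarizeE].
by case=> _ /mapP[m mu ->] ->; exists m; rewrite ?polarizeE.
Qed.

End PolarizationIdeal.

(** * Dimension of polynomial rings *)

Section Dimension.
Variables (n : nat) (K : fieldType).
Local Notation S := {mpoly K[n]}.

Definition deg_le (f : S) d := forall m, m \in msupp f -> (mdeg m <= d)%N.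

Lemma deg_leM f g d e : deg_le f d -> deg_le g e -> deg_le (f * g) (d + e).
Proof.
move=> fd ge m /msuppM_le/allpairsP[[m1 m2] /= [/fd h1 /ge h2 ->]].
by rewrite mdegD leq_add.
Qed.

Lemma deg_le1 d : deg_le 1 d.
Proof. by move=> m; rewrite msupp1 inE => /eqP ->; rewrite mdeg0. Qed.

Lemma deg_leX f d k : deg_le f d -> deg_le (f ^+ k) (k * d).
Proof.
move=> fd; elim: k => [|k IH]; first by rewrite expr0; apply: deg_le1.
by rewrite exprS mulSn; apply: deg_leM.
Qed.

Lemma deg_le_prod (T : finType) (x : T -> S) d :
  (forall i, deg_le (x i) d) -> deg_le (\prod_i x i) (#|T| * d).
Proof.
move=> xd; rewrite -sum_nat_const.
by elim/big_rec2: _ => [|i f k _ IH]; [apply: deg_le1 | apply: deg_leM].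
Qed.

(** Products of n + 1 polynomials with exponents below D number D^(n+1), but their
    monomials have exponents below D C with C independent of D, which leaves a
    space of dimension (D C)^n. For D > C^n there is a linear relation. *)
Lemma algebraic_dependence (x : 'I_n.+1 -> S) :
  exists D (c : {ffun 'I_n.+1 -> 'I_D} -> K),
    (exists e, c e != 0) /\ \sum_e c e *: \prod_i x i ^+ e i = 0.
Proof.
pose d := (\max_i msize (x i))%N; pose C := (n.+1 * d).+1.
pose D := (C ^ n).+1; pose B := (D * C)%N.
pose E := {ffun 'I_n.+1 -> 'I_D}; pose T := {ffun 'I_n -> 'I_B}.
pose X (e : E) : S := \prod_i x i ^+ e i.
have XB e m : m \in msupp (X e) -> forall i, (m i < B)%N.
  have xd i : deg_le (x i ^+ e i) (D * d).
    move=> m' /(@deg_leX _ d); move=> /(_ _) H.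
    apply: leq_trans (H _) _; last by rewrite leq_mul2r (ltnW (ltn_ord _)) orbT.
    move=> m2 /msize_mdeg_lt lt; apply: ltnW; apply: leq_trans lt _.
    exact: (leq_bigmax i).
  move=> /(deg_le_prod xd); rewrite card_ord => md i.
  apply: leq_ltn_trans (_ : (m i <= n.+1 * (D * d))%N) _.
    by apply: leq_trans md; rewrite mdegE (bigD1 i) //= leq_addr.
  by rewrite /B /C mulnS mulnCA -addn1 addnC leq_add2r.
pose mon (t : T) := [multinom (t i : nat) | i < n].
pose M := \matrix_(i < #|E|, j < #|T|) (X (enum_val i))@_(mon (enum_val j)).
(* D > C^n by the choice of D, so D^n C^n < D^(n+1). *)
have cardTE : (#|T| < #|E|)%N.
  by rewrite !card_ffun !card_ord /B expnMn expnS [leqRHS]mulnC ltn_pmul2l ?expn_gt0.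
have : kermx M != 0.
  rewrite kermx_eq0 /row_free; apply: contraL cardTE => /eqP <-.
  by rewrite -leqNgt rank_leq_col.
case/rowV0Pn => v /sub_kermxP vM v0.
exists D, (fun e => v 0 (enum_rank e)); split.
  case/rV0Pn: v0 => i vi; exists (enum_val i); by rewrite enum_valK.
apply/mpolyP => m; rewrite mcoeff0 raddf_sum /=.
under eq_bigr => e _ do rewrite mcoeffZ -/(X e).
have [/forallP mB|] := boolP [forall i, (m i < B)%N]; last first.
  case/forallPn => i mi; rewrite big1 // => e _.
  rewrite memN_msupp_eq0 ?mulr0 //; apply: contra mi => /XB; exact.
pose t : T := [ffun i => Ordinal (mB i)].
have mt : m = mon t by apply/mnmP => i; rewrite mnmE ffunE.
have := congr1 (fun A : 'rV_ _ => A 0 (enum_rank t)) vM.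
rewrite !mxE => vM0; rewrite -[RHS]vM0 (reindex_onto enum_val enum_rank) /=; last first.
  by move=> e _; rewrite enum_rankK.
apply: eq_big => [i|i _]; first by rewrite enum_valK eqxx.
by rewrite mxE enum_valK enum_rankK -mt.
Qed.

(** In a chain P_0 < ... < P_{n+1}, pick x_j in P_{j+1} outside P_j, and an algebraic
    relation among x_0, ..., x_n. Its value is in P_0. Suppose the relation only
    involves x_j, ..., x_n and has value in P_j: divide by the largest power of x_j,
    as P_j is prime, then drop the terms still containing x_j, as it lies in
    P_{j+1}. At the end a nonzero constant lies in P_{n+1}. *)
Lemma prime_chain_le k (P : nat -> set S) : prime_chain k P -> (k <= n)%N.
Proof.
case=> Pp Plt; rewrite leqNgt; apply/negP => ltk.
have /choice[x xP] i : exists x, (i < k)%N -> P i.+1 x /\ ~ P i x.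
  have [/Plt[_ /nonsubset[y [y1 y2]]]|] := boolP (i < k)%N; last by exists 0.
  by exists y.
have [D [c0 [c0N c0E]]] := algebraic_dependence (fun i => x i).
pose E := {ffun 'I_n.+1 -> 'I_D}.
pose sum_from (c : E -> K) j : S :=
  \sum_e c e *: \prod_(i < n.+1 | (j <= i)%N) x i ^+ e i.
(* Rather than removing the variables already treated, the relation keeps all
   exponents and its terms agree on the first j of them. *)
have inv j : (j <= n.+1)%N -> exists c : E -> K, [/\ exists e, c e != 0,
    forall e e', c e != 0 -> c e' != 0 -> forall i : 'I_n.+1, (i < j)%N -> e i = e' i
    & P j (sum_from c j)].
  elim: j => [_|j IH ltj].
    exists c0; split=> //; rewrite /sum_from c0E.
    by case: (Pp 0%N isT) => -[[]].
  have ltjk : (j < k)%N by apply: leq_trans ltj ltk.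
  have [c [[e0 ce0] agree Pc]] := IH (ltnW ltj).
  have [xj1 xj] := xP _ ltjk; pose i0 := Ordinal ltj.
  have [em cem emin] :=
    @arg_minnP _ e0 (fun e : E => c e != 0) (fun e : E => e i0 : nat) ce0.
  pose mm : nat := em i0.
  exists (fun e : E => if e i0 == mm :> nat then c e else 0); split.
  - by exists em; rewrite eqxx.
  - move=> e e'; have [h1 ce|_] := eqVneq (e i0 : nat) mm; last by rewrite eqxx.
    have [h2 ce'|_] := eqVneq (e' i0 : nat) mm; last by rewrite eqxx.
    move=> i; rewrite ltnS leq_eqVlt => /orP[/eqP ij|]; last exact: agree.
    have -> : i = i0 by apply: val_inj.
    by apply: val_inj; rewrite /= h1 h2.
  have [_ primej] := Pp _ (ltnW ltjk).
  have [[Qid _] _] := Pp _ ltjk; have [Q0 QD QM] := Qid.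
  pose rest (e : E) : S := \prod_(i < n.+1 | (j < i)%N) x i ^+ e i.
  pose inner := \sum_e c e *: (x j ^+ (e i0 - mm) * rest e).
  have split_sum : sum_from c j = x j ^+ mm * inner.
    rewrite mulr_sumr; apply: eq_bigr => e _.
    have [->|ce] := eqVneq (c e) 0; first by rewrite !scale0r mulr0.
    rewrite -scalerAr mulrA -exprD subnKC; last exact: emin.
    congr (_ *: _); rewrite (bigD1 i0) //=; congr (_ * _).
    by apply: eq_bigl => i; rewrite ltn_neqAle andbC eq_sym.
  have Pinner : P j.+1 inner.
    have [sub _] := Plt _ ltjk; apply: sub; move: Pc; rewrite split_sum => /primej[]//.
    by move/(ideal_prime_exp (Pp _ (ltnW ltjk))) => [].
  rewrite -[sum_from _ _](subrK inner); apply: QD => //.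
  rewrite /sum_from /inner -sumrB; apply: ideal_sum => // e _.
  have [->|ce] := eqVneq (c e) 0; first by rewrite if_same !scale0r subrr; exact: Q0.
  case: eqP => [->|ne]; first by rewrite subnn expr0 mul1r subrr; exact: Q0.
  have lt : (mm < e i0)%N by rewrite ltn_neqAle eq_sym emin // andbT; apply/eqP.
  have -> : (e i0 - mm = (e i0 - mm).-1.+1)%N by rewrite prednK // subn_gt0.
  rewrite scale0r sub0r exprSr -mulrA [x j * _]mulrC mulrA scalerAl -mulNr.
  exact: QM.
have [c [[e0 ce0] agree]] := inv _ (leqnn _).
have [[Q Q1] _] := Pp _ ltk; case: (Q) => _ _ QM.
rewrite /sum_from (bigD1 e0) //= [X in _ + X]big1 ?addr0 => [|e ne]; last first.
  have [->|ce] := eqVneq (c e) 0; first by rewrite scale0r.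
  by case/eqP: ne; apply/ffunP => i; apply: agree.
rewrite big_pred0 => [|i]; last by rewrite leqNgt ltn_ord.
move=> /(QM ((c e0)^-1)%:MP); rewrite mul_mpolyC scalerA mulVf // scale1r.
exact: Q1.
Qed.

Lemma var_prime_proper (A B : {set 'I_n}) : A \proper B ->
  var_prime A `<` (var_prime B : set S).
Proof.
case/properP => AB [i iB iA]; split; first exact: var_primeS.
by move=> sub; case/negP: iA; apply/(@var_primeX _ K)/sub/var_primeX.
Qed.

(** Primes of these sets form the chain that adds the variables of [s] one by
    one. *)
Definition var_flag (s : seq 'I_n) (k : nat) : {set 'I_n} := [set i in take k s]%SET.

Lemma var_flag_proper s k :
  uniq s -> (k < size s)%N -> var_flag s k \proper var_flag s k.+1.
Proof.
move=> us lt; apply/properP; split.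
  apply/fintype.subsetP => i; rewrite !inE (take_nth (tnth (in_tuple s) (Ordinal lt))) //.
  by rewrite mem_rcons inE => ->; rewrite orbT.
pose i0 := tnth (in_tuple s) (Ordinal lt).
exists (nth i0 s k); rewrite !inE.
  by rewrite (take_nth i0) ?mem_rcons ?mem_head.
have := take_uniq k.+1 us; rewrite (take_nth i0) // rcons_uniq.
by case/andP.
Qed.

(** The variables of [A], listed one by one, give a chain of length #|A|.
    Conversely, any chain ending at the prime of [A] can be continued by the
    remaining n - #|A| variables, and a chain has length at most n. *)
Lemma var_prime_height (A : {set 'I_n}) : prime_height (var_prime A : set S) #|A|.
Proof.
pose s := enum A ++ enum (~: A)%SET.
have us : uniq s.
  rewrite cat_uniq !enum_uniq andbT /=; apply/hasPn => i.
  by rewrite !mem_enum inE.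
have sz : size s = n by rewrite size_cat -!cardE cardsC card_ord.
have flagA : var_flag s #|A| = A.
  by apply/setP => i; rewrite inE take_size_cat ?cardE // mem_enum.
have leA : (#|A| <= n)%N by rewrite -[leqRHS]card_ord max_card.
split.
  exists (fun i => var_prime (var_flag s i)); split; last by rewrite flagA.
  split=> i lti; first exact: var_prime_prime.
  apply/var_prime_proper/var_flag_proper; rewrite ?sz //; exact: leq_trans lti leA.
move=> k [c [[cp clt] ck]]; rewrite -(leq_add2r (n - #|A|)) subnKC //.
pose c' i := if (i <= k)%N then c i else var_prime (var_flag s (#|A| + (i - k))).
apply: (@prime_chain_le _ c'); split=> i lti; rewrite /c'.
  by case: leqP => [/cp//|_]; apply: var_prime_prime.
case: (ltngtP i k) => [lt|gt|ik]; first exact: clt.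
  rewrite subSn 1?ltnW // addnS; apply/var_prime_proper/var_flag_proper => //.
  by rewrite sz; lia.
rewrite ik subSn // subnn addn1 ck -[in X in X `<` _]flagA.
by apply/var_prime_proper/var_flag_proper => //; rewrite sz; lia.
Qed.

Lemma krull_dim_ge d : is_krull_dim S d -> (n <= d)%N.
Proof.
case=> _; apply; have [[c [cP _]] _] := var_prime_height [set: 'I_n]%SET.
by exists c; rewrite cardsT card_ord in cP.
Qed.

Lemma unmixed_witness (u : seq 'X_{1..n}) h :
  is_height (monomial_ideal u : set S) h -> unmixed (monomial_ideal u : set S) ->
  forall w A, witness u w A -> #|A| = h.
Proof.
move=> [hI hmin] [h' [[hI' hmin'] [_ hmax']]] w A wA.
have hA : ass_heights (monomial_ideal u : set S) #|A|.
  by exists (var_prime A); split; [exact: witness_Ass wA | exact: var_prime_height].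
have eh : h = h' by apply/eqP; rewrite eqn_leq hmin // hmin'.
by apply/eqP; rewrite eqn_leq hmin // eh hmax'.
Qed.

End Dimension.

(** * The v-number of a polarization *)

Lemma is_min_ex (A : set nat) : A !=set0 -> exists m, is_min A m.
Proof.
case=> k Ak; have ex : exists m, `[< A m >] by exists k; apply/asboolP.
case: (ex_minnP ex) => m /asboolP Am mmin; exists m; split=> // j Aj.
by apply: mmin; apply/asboolP.
Qed.

Lemma is_min_dominated (A B : set nat) m : is_min A m ->
  (forall a, A a -> exists2 b, B b & (b <= a)%N) ->
  (forall b, B b -> exists2 a, A a & (a <= b)%N) -> is_min B m.
Proof.
move=> [Am mmin] AB BA; have [b Bb bm] := AB _ Am.
have le k : B k -> (m <= k)%N.
  by case/BA => a /mmin ma; apply: leq_trans.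
split=> //; suff -> : m = b by [].
by apply/eqP; rewrite eqn_leq bm le.
Qed.

(** The two bounds put a / p in the interval (k - 1, k]. *)
Lemma ceil_quotient (a p k h : nat) :
  (a <= p * k)%N -> (p * k < a + p)%N -> (h <= k)%N ->
  (k - h)%N%:Z = Num.ceil (a%:Q / p%:Q) - h%:Z.
Proof.
move=> le lt hk; have p0 : (0 < p)%N by lia.
rewrite -subzn //; congr (_ - _); apply/esym/ceil_def.
have pQ : 0 < p%:Q by rewrite ltr0n.
rewrite ltr_pdivlMr // ler_pdivrMr //.
rewrite -!intrM ltr_int ler_int; apply/andP; split; lia.
Qed.

Theorem mainTheorem4 (K : fieldType) (n : nat) (I : set {mpoly K[n]})
    (u : seq 'X_{1..n}) (p d : nat) (F : fieldType)
    (Igen : minimal_monomial_generators I u)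
    (Iproper : is_proper_ideal I)
    (Iunmixed : unmixed I)
    (p_prime : prime p)
    (dimSP : is_krull_dim {mpoly K[pol_nvars u]} d)
    (p_gt_dim : (d < p)%N)
    (charF : p \in [pchar F]) :
  exists v a h : nat,
    [/\ is_vnumber I v,
        is_vnumber (polarization u K) v,
        is_alpha p (polarization u F) a,
        is_height I h
      & v%:Z = Num.ceil (a%:Q / p%:Q) - h%:Z].
Proof.
have [h [hI _]] := Iunmixed; have [IE _] := Igen; subst I.
have card_ass := unmixed_witness hI Iunmixed.
have card_cov A mA := (@card_min_cover _ u _ card_ass A mA).2.
have [w0 [A0 [_ wA0 _]]] := witness_above (proper_mon_mem0 Iproper).
have [|v vmin] := @is_min_ex [set mdeg w | w in [set w | exists A, witness u w A]].
  by exists (mdeg w0), w0 => //; exists A0.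
have vPmin : is_min [set mdeg b | b in [set b | exists A, witness (pol_gens u) b A]] v.
  apply: is_min_dominated vmin _ _ => _ [w [A wA] <-].
    have [b [B [bB le]]] := witness_polarize wA.
    by exists (mdeg b) => //; exists b => //; exists B.
  have [b [B [bB le]]] := witness_depolarize card_ass wA.
  by exists (mdeg b) => //; exists b => //; exists B.
have [[b [B bB] bv] vle] := vPmin.
have [e ew ele] :=
  frob_witness_of_witness (@pol_gens_squarefree _ u) card_cov (prime_gt1 p_prime) bB.
have [|a amin] := @is_min_ex [set mdeg e | e in [set e | frob_witness (pol_gens u) p e]].
  by exists (mdeg e), e.
exists v, a, h; split=> //.
- exact/is_vnumberE.
- by rewrite polarizationE; apply/is_vnumberE.
- by rewrite polarizationE; apply/is_alphaE.
have le_a : (a <= p * v + p.-1 * h)%N.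
  by apply: leq_trans (amin.2 _ _) _; [exists e|rewrite -bv].
have [[e' e'w e'a] _] := amin.
have [b' [B' [wB' le]]] :=
  witness_of_frob_witness (@pol_gens_squarefree _ u) card_cov (prime_gt0 p_prime) e'w.
have vle' : (v <= mdeg b')%N by apply: vle; exists b' => //; exists B'.
have Nd := krull_dim_ge dimSP.
have := @ceil_quotient a p (v + h) h; rewrite addnK; apply; last exact: leq_addl.
  apply: leq_trans le_a _; rewrite mulnDr leq_add2l leq_mul2r leq_pred orbT //.
apply: (@leq_ltn_trans (p * (mdeg b' + h))).
  by rewrite leq_mul2l leq_add2r vle' orbT.
apply: leq_ltn_trans le _; rewrite e'a ltn_add2l; exact: leq_ltn_trans Nd p_gt_dim.
Qed.
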